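(* Let $\mathcal G$ be a separated Rota-Baxter hierarchy over a field $K$. Orienting the defining relations (1)–(9) of the ring of partial integral operators $\mathcal G[\int]$ (listed in the context, together with the implicit and extra rules described there) from left to right, one obtains a Noetherian reduction system, i.e. there is no infinite sequence of reductions.
   Context: $K$ is a field of characteristic zero. The algebra $\mathcal G$ is commutative and unital; all bialgebras are commutative and cocommutative. Rota-Baxter operators have weight zero: a linear operator $P$ with $P(u)P(v)=P(uP(v))+P(P(u)v)$. A Rota-Baxter algebra $(G,P)$ over $K$ is ordinary if $P$ is injective and $G=K\oplus\operatorname{im}P$. Matrices. $\mathcal M(K)$ is the monoid of infinite matrices (indexed by $1,2,\dots$) of the form $I+\tilde M$ with $\tilde M$ having finitely many nonzero rows and columns; $M\in\mathcal M_n(K)=K^{n\times n}$ is identified with $\mathrm{diag}(M,I)$. $E_n:=I-e_{nn}$; $d_{i,\lambda}:=I+(\lambda-1)e_{ii}$. A row $a=(a_1,\dots,a_n)$ is identified with the matrix having first row $a$ and all further rows equal to those of $I$. For $w=(w_{i+1},\dots,w_n)^{\top}\in K^{n-i}$, $L_i(w):=I+\sum_{k>i}w_ke_{ki}$, so $L_i^{-1}(w)=L_i(-w)$; unit vectors $e_k\in K^{n-i}$ are numbered by position. For $w\in K^{n-j}$ and $i<j$, $L_{j-i}(w)$ acting on $K^{n-i}$ denotes the corresponding $(n-i)\times(n-i)$ matrix. Separated Rota-Baxter hierarchy. Let $(B,\Delta,\epsilon)$ be a $K$-bialgebra with product $\nabla$, unit $1$; put $\mathsf e:=1\circ\epsilon$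 and $f\oplus g:=\nabla(f\otimes g)\Delta$ for linear endomorphisms. $(B,\Delta,\epsilon,\int)$ is a scaled Rota-Baxter bialgebra if $(B,\int)$ is an ordinary Rota-Baxter algebra over $K$, $\mathsf e$ is the projector onto $K$ along $\operatorname{im}\int$, $\Delta\int=(\int\otimes\mathrm{id})\Delta+(\mathsf e\otimes\mathrm{id})\Delta\int$, and there is a scaling $\lambda\mapsto\lambda^*$, i.e. a monoid homomorphism from $(K\setminus\{0\},\cdot)$ to bialgebra endomorphisms of $B$ such that, with $0^*:=\mathsf e$, $\lambda\mapsto\lambda^*$ is a semiring homomorphism $(K,+,\cdot)\to(\text{bialgebra endomorphisms},\oplus,\circ)$, and $\int\lambda^*=\lambda^{-1}\lambda^*\int$ for $\lambda\ne0$. The separated Rota-Baxter hierarchy $\mathcal G=\mathfrak H(B)$ is the direct limit of $\mathcal G_n=B^{\otimes n}$ (embedded in $\mathcal G_{n+1}$ by $f\mapsto f\otimes1$), with operators $\int^{x_n}=\mathrm{id}^{\otimes(n-1)}\otimes\int$ and matrix action $M^*(f_1\otimes\cdots\otimes f_n)=(M_{1\bullet}^*f_1)\cdots(M_{n\bullet}^*f_n)$ for $M\in\mathcal M_n(K)$, where $a^*:=(a_1^*\otimes\cdots\otimes a_n^* )\Delta^n:B\to B^{\otimes n}$ for a row $a$, and $\Delta^n$ is the iterated coproduct. Notation. $f[M]:=M^*(f)$; $f[i\;j]:=f[(i\;j)]$ for transpositions (equal to $f$ if $i=j$), and $f[a]$ likewise for a row $a$. For $f\in\mathcal G_1$, $f(x_i):=(1\;i)^*f\in\mathcal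 G_{(i)}$, where $\mathcal G_{(i)}=(1\;i)^*\mathcal G_1$; $\mathcal G_\alpha$ is the subalgebra generated by the $\mathcal G_{(i)}$, $i\in\alpha$. Fix a $K$-basis of $\mathcal G_1$ containing $1$, and let $\mathcal B$ be the induced tensor basis of $\mathcal G$. Tensor expansion: every $g\in\mathcal G_\alpha$ ($\alpha$ finite) is written via this basis (basis expansion, with scalars absorbed in one component) as $g=\sum_{\mu=1}^r\prod_{j\in\alpha}g\{j\}_\mu$ with $g\{j\}_\mu\in\mathcal G_{(j)}$; for $\alpha=\{1,\dots,n\}$ put $g\{j\}'_\mu:=\prod_{k\ne j}g\{k\}_\mu$. For a sequence $\gamma$, $\gamma[M]$ is componentwise. Summation over repeated Greek indices is implied. Reduction system. Work in the free associative $K$-algebra on the letters $b\in\mathcal B\setminus\{1\}$, $M^*$ ($M\in\mathcal M(K)$, $M\ne I$), and $A_n$ ($n\ge1$). The symbols $1\in\mathcal B$ and $I^*$ stand for the empty word, and an element of $\mathcal G$ occurring on a right-hand side stands for its expansion in the basis $\mathcal B$; on right-hand sides all matrix products, substitutions and coefficient multiplications are carried out. The rules, for all positive integers $i,j$ (with $i<j$ in (3),(4),(7)), all $M\in\mathcal M(K)$, all basis elements $g,h$ of $\mathcal G_1$ (in (1): $g\in\mathcal B$), and $n$ large enough for the matrices involved to lie in $\mathcal M_n(K)$, are: (1) $M^*g\to g[M]M^*$. (2) $M^*A_i\to0$ if the $i$-th row of $M$ is zero. (3) $A_j\,g(x_i)\to g(x_i)A_j$. (4) $A_i\,g(x_j)\to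 g(x_j)A_i$. (5) If $i:=\min\{k\mid M_{kj}\ne0\}$ exists and $M$ is not of the form $L_j(v)$: $A_j\,g(x_j)M^*\to M_{ij}^{-1}\gamma'_\mu(1-E_j^* )\tilde M^*A_i\,\gamma[d_{j,1/M_{ij}}][i\;j]_\mu L_i(l)^*$, where $l=(l_{i+1},\dots,l_n)$, $l_k=M_{kj}/M_{ij}$, $\tilde M=L_i(-l)M$, $\gamma'=\tilde g\{j\}'$, $\gamma=\tilde g\{j\}$, and $\tilde g=g[a]$ for the row $a$ with $a_j=1$, $a_k=-M_{ik}/M_{ij}$ ($k\ne j$). (6) If the $j$-th column of $M$ is zero: $A_j\,g(x_j)M^*\to\big(\int^{x_j}g(x_j)\big)M^*$. (7) For $v\in K^{n-i}$, $w\in K^{n-j}$: $A_jh(x_j)L_j(w)^*A_i\,g(x_i)L_i(v)^*\to(1-E_j^* )A_i\,\eta'_\mu L_i(v')^*A_j\,\eta_\mu L_j(w)^*$, where $v'=L_{j-i}^{-1}(w)v$, $\eta'=g(x_i)\tilde h\{i\}$, $\eta=\tilde h\{j\}$, $\tilde h=h[e_j-v_je_i]\in\mathcal G_{(i,j)}$. (8) For $v,w\in K^{n-i}$, $w\ne0$: $A_ih(x_i)L_i(w)^*A_i\,g(x_i)L_i(v)^*\to L_k^{-1}(w')^*\chi''[k\;n{+}1]_\mu\big(L_i(\bar w)^*A_i\,g(x_i)\chi'_\mu L_i(v')^*-A_i\,g(x_i)\chi'_\mu L_i(v'+\bar w)^*\big)A_k\,\chi_\mu L_k(w')^*$, where $k=\min\{m>i\mid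 w_m\ne0\}$, $\bar w=w_ke_{k-i}$, $w'=(w_{k+1},\dots,w_n)^\top/w_k$, $v'=L_{k-i}^{-1}(w')v$, $\tilde h=\frac1{w_k}h[-(v_k/w_k)e_i+e_k/w_k-e_{n+1}/w_k]\in\mathcal G_{(i,k,n+1)}$, $\chi''=\tilde h\{n+1\}$, $\chi'=\tilde h\{i\}$, $\chi=\tilde h\{k\}$. (9) $A_j\,g(x_j)A_j\to\big(\int^{x_j}g(x_j)\big)A_j-A_j\big(\int^{x_j}g(x_j)\big)$. Implicit rules: the instances of these rules in which some coefficients are $1$ or some of the matrices $L_i(v),L_j(w)$ equal $I$, the corresponding letters being absent; instances with identical left and right sides are excluded. Extra rules: $bb'\to$ the basis expansion of the product $bb'$ in $\mathcal G$; $M^*N^*\to(NM)^*$; and $A_jA_i\to A_iA_j$ for $i<j$. A reduction step replaces, in one monomial occurring with nonzero coefficient in an element of the free algebra, one occurrence of a left-hand side by the corresponding right-hand side. *)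

(* Defs.v *)
From HB Require Import structures.
From mathcomp Require Import all_boot all_order all_algebra finmap.
From mathcomp.multinomials Require Import monalg.

Set Implicit Arguments.
Unset Strict Implicit.
Unset Printing Implicit Defensive.

Import GRing.Theory.
Local Open Scope ring_scope.

(* Variables, matrix rows and matrix columns are numbered from 0: the index
   [i : nat] stands for the variable x_(i+1).  In particular M_n(K) is the set
   of matrices that agree with I outside the indices i < n, and the first
   variable outside G_n is the one of index [n]. *)

(* [{malg K[X]}] is the free K-module on X; [<< x >>] is the basis vector x
   and [m@_x] the coefficient of x in m. *)
Definition lext (K : fieldType) (X : choiceType) (V : lmodType K)
    (f : X -> V) (m : {malg K[X]}) : V :=
  \sum_(x <- msupp m) m@_x *: f x.

(* [bcoord] and its two laws say that the family [bvec] is a K-basis of B. *)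
Record unital_basis (K : fieldType) (B : comAlgType K) := UnitalBasis {
  bidx :> choiceType;
  bvec : bidx -> B;
  bcoord : {linear B -> {malg K[bidx]}};
  bcoord_bvec : forall x, bcoord (bvec x) = << x >>;
  lext_bcoord : forall f, lext bvec (bcoord f) = f;
  bone : bidx;
  bvec_bone : bvec bone = 1
}.

Section Tensor.

Variables (K : fieldType) (B : comAlgType K) (E : unital_basis B).

(* The n-th tensor power of B: the basis vector << t >> is the tensor
   bvec t_0 (x) ... (x) bvec t_(n-1). *)
Definition tens (n : nat) := {malg K[n.-tuple E]}.
HB.instance Definition _ n := GRing.Lmodule.on (tens n).

(* The k-th tensor factor of << t >>, or 1 if t has no such factor. *)
Definition tfactor n (t : n.-tuple E) (k : nat) : B :=
  bvec (nth (bone E) t k).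

Definition tcons n (f : B) (u : tens n) : tens n.+1 :=
  lext (fun x => lext (fun t => << cons_tuple x t >> : tens n.+1) u)
       (bcoord E f).

Definition trcons n (u : tens n) (f : B) : tens n.+1 :=
  lext (fun t => lext (fun x => << rcons_tuple t x >> : tens n.+1)
                      (bcoord E f)) u.

(* The pure tensor f 0 (x) ... (x) f (n - 1): its coefficient at t is the
   product of the coordinates of the f k at t_k. *)
Fixpoint tpure n (f : nat -> B) : tens n :=
  if n is n'.+1 then tcons (f 0%N) (tpure n' (fun k => f k.+1))
  else << [tuple] >>.

Definition tmul n (u v : tens n) : tens n :=
  lext (fun s => lext (fun t =>
    tpure n (fun k => tfactor s k * tfactor t k)) v) u.

Definition tmap n (phi : nat -> B -> B) (u : tens n) : tens n :=
  lext (fun t => tpure n (fun k => phi k (tfactor t k))) u.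

Definition tmap2 (phi psi : B -> B) : tens 2 -> tens 2 :=
  tmap (nth id [:: phi; psi]).

(* The tensor basis of the direct limit G: a tuple t stands for the family
   that is extended by bone E, which is the embedding u |-> u (x) 1. *)
Definition gbasis := {fsfun nat -> E with bone E}.
HB.instance Definition _ := Choice.on gbasis.

Definition galg := {malg K[gbasis]}.
HB.instance Definition _ := GRing.Lmodule.on galg.

Definition gone : gbasis := [fsfun of _ => bone E].

(* The basis element b satisfies << b >> \in G_n iff gsize b <= n. *)
Definition gsize (b : gbasis) : nat := \max_(k <- finsupp b) k.+1.

Definition gsingle (i : nat) (x : E) : gbasis := [fsfun gone with i |-> x].

Definition greset (b : gbasis) (i : nat) : gbasis :=
  [fsfun b with i |-> bone E].

Definition tuple_gbasis n (t : n.-tuple E) : gbasis :=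
  [fsfun k in [fset k in iota 0 n]%fset => nth (bone E) t k].

Definition inG n (u : tens n) : galg :=
  lext (fun t => << tuple_gbasis t >> : galg) u.

Definition gpure n (f : nat -> B) : galg := inG (tpure n f).

Definition gmul (f g : galg) : galg :=
  lext (fun b => lext (fun c =>
    gpure (maxn (gsize b) (gsize c)) (fun k => bvec (b k) * bvec (c k))) g) f.

End Tensor.

Section Bialgebra.

Variables (K : fieldType) (B : comAlgType K) (E : unital_basis B).
Variables (Delta : {linear B -> tens E 2}) (eps : {linear B -> K^o}).

Definition is_bialgebra : Prop :=
  [/\ forall f, lext (fun t => trcons (Delta (tfactor t 0)) (tfactor t 1))
                     (Delta f) =
                lext (fun t => tcons (tfactor t 0) (Delta (tfactor t 1)))
                     (Delta f),
      forall f,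
        lext (fun t => eps (tfactor t 0) *: tfactor t 1) (Delta f) = f /\
        lext (fun t => eps (tfactor t 1) *: tfactor t 0) (Delta f) = f,
      Delta 1 = tpure E 2 (fun=> 1) /\
      (forall f g, Delta (f * g) = tmul (Delta f) (Delta g)) &
      eps 1 = 1 /\ (forall f g, eps (f * g) = eps f * eps g)].

Definition is_cocommutative : Prop :=
  forall f, lext (fun t => tpure E 2 (nth 1 [:: tfactor t 1; tfactor t 0]))
                 (Delta f) = Delta f.

Definition is_bialgebra_endo (phi : B -> B) : Prop :=
  [/\ linear phi, monoid_morphism phi,
      forall f, Delta (phi f) = tmap2 phi phi (Delta f) &
      forall f, eps (phi f) = eps f].

(* phi (+) psi = nabla (phi (x) psi) Delta *)
Definition convolution (phi psi : B -> B) (f : B) : B :=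
  lext (fun t => phi (tfactor t 0) * psi (tfactor t 1)) (Delta f).

Definition counit_proj (f : B) : B := (eps f)%:A.

Definition is_scaling (star : K -> B -> B) : Prop :=
  [/\ forall c, is_bialgebra_endo (star c),
      star 0 =1 counit_proj,
      star 1 =1 id,
      forall c d, star (c * d) =1 star c \o star d &
      forall c d, star (c + d) =1 convolution (star c) (star d)].

Definition is_rota_baxter (P : B -> B) : Prop :=
  forall f g, P f * P g = P (f * P g) + P (P f * g).

Definition is_ordinary (P : B -> B) : Prop :=
  [/\ injective P,
      forall f, exists c g, f = c%:A + P g &
      forall c g, c%:A = P g -> c%:A = 0 :> B].

Definition is_scaled_rb (rbint : {linear B -> B}) (star : K -> B -> B) : Prop :=
  [/\ is_rota_baxter rbint /\ is_ordinary rbint,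
      forall c g, counit_proj (c%:A + rbint g) = c%:A,
      forall f, Delta (rbint f) =
        tmap2 rbint id (Delta f) + tmap2 counit_proj id (Delta (rbint f)),
      is_scaling star &
      forall c f, c != 0 -> rbint (star c f) = c^-1 *: star c (rbint f)].

End Bialgebra.

Record scaled_rb_bialgebra (K : fieldType) (B : comAlgType K)
    (E : unital_basis B) := ScaledRBBialgebra {
  cop : {linear B -> tens E 2};
  counit : {linear B -> K^o};
  rbint : {linear B -> B};
  scale : K -> B -> B;
  bialgebraP : is_bialgebra cop counit;
  cocommutativeP : is_cocommutative cop;
  scaled_rbP : is_scaled_rb cop counit rbint scale
}.

Section Matrices.

Variable K : fieldType.

(* Finitely supported functions with the entries of I as default values *)
Definition imx := {fsfun nat * nat -> K of p => (p.1 == p.2)%:R}.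
HB.instance Definition _ := Choice.on imx.

Definition imx1 : imx := [fsfun of p => (p.1 == p.2)%:R].

(* diag(A, I) for the n x n matrix with entries A i j *)
Definition imx_diag (n : nat) (A : nat -> nat -> K) : imx :=
  [fsfun p in [fset p in [seq (i, j) | i <- iota 0 n, j <- iota 0 n]]%fset =>
     A p.1 p.2].

(* M lies in M_n(K) iff imx_size M <= n. *)
Definition imx_size (M : imx) : nat :=
  \max_(p <- finsupp M) maxn p.1.+1 p.2.+1.

Definition imx_mul (M N : imx) : imx :=
  let n := maxn (imx_size M) (imx_size N) in
  imx_diag n (fun i j => \sum_(k < n) M (i, val k) * N (val k, j)).

Definition Emx (n : nat) : imx := [fsfun imx1 with (n, n) |-> 0].

Definition dmx (i : nat) (c : K) : imx := [fsfun imx1 with (i, i) |-> c].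

Definition swapmx (i j : nat) : imx :=
  imx_diag (maxn i j).+1
    (fun k m => (m == if k == i then j else if k == j then i else k)%:R).

Definition rowmx (n : nat) (a : nat -> K) : imx :=
  imx_diag n (fun i j => if i == 0%N then a j else (i == j)%:R).

(* A vector w = (w_(i+1), ..., w_(n-1)), read with absolute indices *)
Definition ent n i (w : 'cV[K]_(n - i.+1)) (k : nat) : K :=
  \sum_(p < n - i.+1 | (i.+1 + p)%N == k) w p ord0.

Definition Lmx n i (w : 'cV[K]_(n - i.+1)) : imx :=
  imx_diag n (fun k j => (k == j)%:R + (j == i)%:R * ent w k).

(* L_(j-i)(w) as a matrix acting on vectors indexed by i+1, ..., n-1 *)
Definition Lsub n i j (w : 'cV[K]_(n - j.+1)) : 'M[K]_(n - i.+1) :=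
  \matrix_(p, q) ((p == q)%:R + ((i.+1 + q)%N == j)%:R * ent w (i.+1 + p)).

Definition is_Lmx (j : nat) (M : imx) : Prop :=
  exists n (v : 'cV[K]_(n - j.+1)), M = Lmx v.

End Matrices.

Arguments imx1 {K}.
Arguments Emx {K}.
Arguments swapmx {K}.

Section Hierarchy.

Variables (K : fieldType) (B : comAlgType K) (E : unital_basis B).
Variable H : scaled_rb_bialgebra E.

Local Notation G := (galg E).
Local Notation gb := (gbasis E).

(* Delta^n : B -> B^(x)n; Delta^1 is the identity by the counit law. *)
Fixpoint copn n (f : B) : tens E n :=
  if n is n'.+1 then
    lext (fun t => tcons (tfactor t 0) (copn n' (tfactor t 1))) (cop H f)
  else (counit H f : K) *: << [tuple] >>.

(* a^* for the row a = (a 0, ..., a (n - 1)) *)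
Definition row_act n (a : nat -> K) (f : B) : G :=
  inG (tmap (fun k => scale H (a k)) (copn n f)).

(* M^*: on a basis element b of G_n, with M \in M_n(K), this is the product
   of the (row i of M)^* applied to the i-th factor of b. *)
Definition mx_act (M : imx K) (g : G) : G :=
  lext (fun b : gb => let n := maxn (imx_size M) (gsize b) in
    \big[@gmul _ _ E / << gone E >>]_(i < n)
       row_act n (fun k => M (val i, k)) (bvec (b i))) g.

Definition gint (j : nat) (g : G) : G :=
  lext (fun b : gb => gpure E (maxn (gsize b) j.+1)
    (fun k => if k == j then rbint H (bvec (b k)) else bvec (b k))) g.

(* f(x_i) for the basis element f = bvec x.  By the counit law and
   0^* = counit_proj, it is the image of gvar 0 x under swapmx 0 i. *)
Definition gvar (i : nat) (x : E) : G := << gsingle i x >>.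

Definition letter : Type :=
  ({b : gb | b != gone E} + {M : imx K | M != imx1} + nat)%type.
HB.instance Definition _ := Choice.on letter.

(* 1 and I^* are the empty word. *)
Definition wB (b : gb) : seq letter :=
  if insub b is Some l then [:: inl (inl l)] else [::].
Definition wM (M : imx K) : seq letter :=
  if insub M is Some l then [:: inl (inr l)] else [::].
Definition wA (n : nat) : seq letter := [:: inr n].

Definition freealg := {malg K[{fmonom letter}]}.
HB.instance Definition _ := GRing.Lalgebra.on freealg.

Definition mon (s : seq letter) : freealg := << FMonom s >>.

Definition fG (g : G) : freealg := lext (fun b => mon (wB b)) g.
Definition fM (M : imx K) : freealg := mon (wM M).
Definition fA (n : nat) : freealg := mon (wA n).

(* Tensor expansions: h is the sum over b \in msupp h of h@_b << b >>, where
   << b >> is the product of the gvar k (b k).  The scalar h@_b is put in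
   front of each summand, as all right-hand sides are multilinear. *)
Definition tsum (h : G) (F : gb -> freealg) : freealg := lext F h.

Definition rhs5 n (M : imx K) (i j : nat) (x : E) : freealg :=
  let l : 'cV[K]_(n - i.+1) := \col_p (M ((i.+1 + p)%N, j) / M (i, j)) in
  let M' := imx_mul (Lmx (- l)) M in
  let a k := if k == j then 1 else - (M (i, k) / M (i, j)) in
  tsum (mx_act (rowmx n a) (gvar 0 x)) (fun b =>
    (M (i, j))^-1 *:
    (fG << greset b j >> * (1 - fM (Emx j)) * fM M' * fA i
     * fG (mx_act (swapmx i j) (mx_act (dmx j (M (i, j))^-1) (gvar j (b j))))
     * fM (Lmx l))).

Definition rhs7 n (i j : nat) (h g : E)
    (w : 'cV[K]_(n - j.+1)) (v : 'cV[K]_(n - i.+1)) : freealg :=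
  let v' := Lsub i (- w) *m v in
  let a k := if k == j then 1 else if k == i then - ent v j else 0 in
  tsum (mx_act (rowmx n a) (gvar 0 h)) (fun b =>
    (1 - fM (Emx j)) * fA i * fG (gmul (gvar i g) (gvar i (b i)))
    * fM (Lmx v') * fA j * fG (gvar j (b j)) * fM (Lmx w)).

Definition rhs8 n (i k : nat) (h g : E) (w v : 'cV[K]_(n - i.+1)) : freealg :=
  let wk := ent w k in
  let wbar : 'cV[K]_(n - i.+1) := \col_p (((i.+1 + p)%N == k)%:R * wk) in
  let w' : 'cV[K]_(n - k.+1) := \col_p (ent w (k.+1 + p) / wk) in
  let v' := Lsub i (- w') *m v in
  let a m := if m == i then - (ent v k / wk) else
             if m == k then wk^-1 else
             if m == n then - wk^-1 else 0 in
  tsum (wk^-1 *: mx_act (rowmx n.+1 a) (gvar 0 h)) (fun b =>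
    let chi' := fG (gmul (gvar i g) (gvar i (b i))) in
    fM (Lmx (- w')) * fG (mx_act (swapmx k n) (gvar n (b n)))
    * (fM (Lmx wbar) * fA i * chi' * fM (Lmx v')
       - fA i * chi' * fM (Lmx (v' + wbar)))
    * fA k * fG (gvar k (b k)) * fM (Lmx w')).

(* The implicit rules are the instances where a word wB or wM is empty. *)
Inductive rule : seq letter -> freealg -> Prop :=
(* The instances of Rule1 with b = 1 or M = I have identical sides. *)
| Rule1 (M : imx K) (b : gb) : M != imx1 -> b != gone E ->
    rule (wM M ++ wB b) (fG (mx_act M << b >>) * fM M)
| Rule2 (M : imx K) i : (forall k, M (i, k) = 0) ->
    rule (wM M ++ wA i) 0
| Rule3 i j (g : E) : (i < j)%N ->
    rule (wA j ++ wB (gsingle i g)) (fG (gvar i g) * fA j)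
| Rule4 i j (g : E) : (i < j)%N ->
    rule (wA i ++ wB (gsingle j g)) (fG (gvar j g) * fA i)
| Rule5 n (M : imx K) i j (g : E) :
    (imx_size M <= n)%N -> (i < n)%N -> (j < n)%N ->
    M (i, j) != 0 -> (forall k, (k < i)%N -> M (k, j) = 0) ->
    ~ is_Lmx j M ->
    rule (wA j ++ wB (gsingle j g) ++ wM M) (rhs5 n M i j g)
| Rule6 (M : imx K) j (g : E) : (forall k, M (k, j) = 0) ->
    rule (wA j ++ wB (gsingle j g) ++ wM M) (fG (gint j (gvar j g)) * fM M)
| Rule7 n i j (h g : E) (w : 'cV[K]_(n - j.+1)) (v : 'cV[K]_(n - i.+1)) :
    (i < j)%N -> (j < n)%N ->
    rule (wA j ++ wB (gsingle j h) ++ wM (Lmx w)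
          ++ wA i ++ wB (gsingle i g) ++ wM (Lmx v)) (rhs7 h g w v)
| Rule8 n i k (h g : E) (w v : 'cV[K]_(n - i.+1)) :
    (i < k)%N -> (k < n)%N ->
    ent w k != 0 -> (forall m, (i < m < k)%N -> ent w m = 0) ->
    rule (wA i ++ wB (gsingle i h) ++ wM (Lmx w)
          ++ wA i ++ wB (gsingle i g) ++ wM (Lmx v)) (rhs8 k h g w v)
| Rule9 j (g : E) :
    rule (wA j ++ wB (gsingle j g) ++ wA j)
         (fG (gint j (gvar j g)) * fA j - fA j * fG (gint j (gvar j g)))
| RuleMulB (b c : gb) : b != gone E -> c != gone E ->
    rule (wB b ++ wB c) (fG (gmul << b >> << c >>))
| RuleMulM (M N : imx K) : M != imx1 -> N != imx1 ->
    rule (wM M ++ wM N) (fM (imx_mul N M))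
| RuleSwapA i j : (i < j)%N ->
    rule (wA j ++ wA i) (fA i * fA j).

Definition reduces (a a' : freealg) : Prop :=
  exists u v lhs rhs,
    let c := a@_(FMonom (u ++ lhs ++ v)) in
    [/\ rule lhs rhs, mon lhs != rhs, c != 0 &
        a' = a - c *: mon (u ++ lhs ++ v) + c *: (mon u * rhs * mon v)].

End Hierarchy.

Definition noetherian (T : Type) (R : T -> T -> Prop) : Prop :=
  ~ exists s : nat -> T, forall n, R (s n) (s n.+1).

(* Main.v *)
Require Import Defs.
From mathcomp Require Import all_boot all_order all_algebra finmap.
From mathcomp.multinomials Require Import monalg.
From Stdlib Require Import Inverse_Image.

(** Cut a word at its operator letters: it is W_0 A_(i_1) W_1 ... A_(i_r) W_r,
    where the blocks W_k consist of basis elements and matrices.  Apart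
    from [Rule2], whose right-hand side is 0, each rule either removes an
    operator, or keeps their number and improves the rightmost block that it
    meets, together with the operator in front of it; further to the right
    nothing changes, and to the left anything may happen, such as a long prefix
    being pushed out of a block.  Hence words are compared by their number of
    operators first, and then lexicographically from the right, block by block.

    It remains to say what improves in a block W behind an operator A_i.  The
    obstacle is that [Rule5] and the exchanges of two operators, namely [Rule7],
    [Rule8] and [RuleSwapA], seem to work against each other: the exchanges
    increase the index of the right operator and may put new letters
    into its block, whereas [Rule5] may decrease the index again.  They are
    reconciled by the lower unitriangular matrices, which form a monoid that
    contains all L_i(v):
    - the exchanges only put matrices L_k(w) into the right block;
    - if M is lower unitriangular, then the first nonzero entry of its column j
      is the diagonal one, so that [Rule5] keeps the index and replaces M,
      which is not of the form L_j(v), by a matrix L_j(l);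
    - otherwise [Rule5] replaces M by the lower unitriangular matrix L_i(l).
    So the following numbers decrease lexicographically: the number of matrices
    in W that are not lower unitriangular, N - i for a common bound N of all
    indices, the number of matrices in W, the number of those that are not of
    the form L_i(v), and finally a weight that takes care of [Rule1] and of
    the loss of basis elements ([block_rank]).

    The bound N exists because no rule moves out of the index range given by the
    operators and matrices: [Rule5] and [Rule8] read off the new operator index
    from a nontrivial entry of a matrix ([rule_smaller]).

    A reduction of an element of the free algebra replaces one monomial of its
    support by smaller ones, and such replacements terminate for finite subsets
    of a well-founded order ([descent_wf]). *)

Set Implicit Arguments.
Unset Strict Implicit.
Unset Printing Implicit Defensive.

Import GRing.Theory.

(** * Comparing sequences of natural numbers *)

Fixpoint lexlt (s t : seq nat) : bool :=
  match s, t with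
  | x :: s', y :: t' => (x < y) || (x == y) && lexlt s' t'
  | _, _ => false
  end.

Definition shortlex (s t : seq nat) : bool :=
  (size s < size t) || (size s == size t) && lexlt s t.

Lemma lexlt_catr p s t : lexlt (p ++ s) (p ++ t) = lexlt s t.
Proof. by elim: p => //= x p ->; rewrite ltnn eqxx. Qed.

Lemma lexlt_catl s t s' t' : lexlt s t -> lexlt (s ++ s') (t ++ t').
Proof.
elim: s t => [|x s IH] [|y t] //= /orP[->//|/andP[-> /IH ->]].
by rewrite orbT.
Qed.

Lemma lexlt_irr s : lexlt s s = false.
Proof. by elim: s => //= x s ->; rewrite ltnn andbF. Qed.

Lemma lexlt_cons x y s t : x <= y -> lexlt s t -> lexlt (x :: s) (y :: t).
Proof. by rewrite leq_eqVlt => /orP[/eqP->|] /= ->; rewrite ?eqxx ?orbT. Qed.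

Lemma lexlt_head x y s t : x < y -> lexlt (x :: s) (y :: t).
Proof. by move=> /= ->. Qed.

Lemma lexlt_wf :
  well_founded (fun s t => (size s == size t) && lexlt s t).
Proof.
move=> s; move: {2}(size s) (erefl (size s)) => n.
elim: n s => [|n IHn] s size_s.
  rewrite (size0nil size_s); apply: Acc_intro => t /andP[_].
  by case: t => [|y t] lt_t; discriminate lt_t.
case: s size_s => [size_s|x s [size_s]]; first discriminate size_s.
elim/ltn_ind: x s size_s => x IHx s size_s.
have acc_s := IHn s size_s; elim: acc_s size_s => {}s _ IHs size_s.
apply: Acc_intro => t /andP[/eqP size_t].
case: t size_t => [size_t|y t [size_t]] /=; first discriminate size_t.
case/orP=> [lt_yx|/andP[/eqP -> lt_ts]].
  by apply: IHx; rewrite ?size_t.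
by apply: IHs; rewrite ?size_t ?eqxx.
Qed.

Lemma shortlex_wf : well_founded (fun s t => shortlex s t).
Proof.
move=> s; have [n] := ubnP (size s); elim: n s => [s|n IHn s].
  by rewrite ltn0.
elim: (lexlt_wf s) => {}s _ IHs /ltnSE le_sn.
apply: Acc_intro => t /orP[lt_ts|/[dup] lt_ts /andP[/eqP size_t _]].
  by apply: IHn; apply: leq_trans le_sn.
by apply: IHs => //; rewrite ltnS size_t.
Qed.

Arguments lexlt : simpl never.

(** * Finite subsets of a well-founded order *)

Section Descent.

Variables (X : eqType) (lt : X -> X -> Prop).

(** The finite subset [s] loses [m] and possibly other elements, and gains only
    elements below [m]. *)
Definition descent (s' s : seq X) : Prop :=
  exists2 m, m \in s & m \notin s' /\
    forall y, y \in s' -> y \in s \/ lt y m.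

(** Every step from a subset is also a step from the larger set, so the elements
    that get lost in a step are harmless. *)
Lemma Acc_subset (s t : seq X) :
  {subset t <= s} -> Acc descent s -> Acc descent t.
Proof.
move=> sub_ts acc_s; apply: Acc_intro => u [m mt [mu u_t]].
apply: (Acc_inv acc_s).
exists m; first exact: sub_ts.
by split=> // y /u_t [/sub_ts|]; [left | right].
Qed.

(** Adding one element [x] to an accessible set keeps it accessible, by
    induction on [x] and then on the set: a step that removes [x] leaves a subset
    of the old set with finitely many smaller elements added, and any other step
    is a step of the old set. *)
Lemma descent_wf : well_founded lt -> well_founded descent.
Proof.
move=> wf_lt.
have Acc_cons x : forall s, Acc descent s -> Acc descent (x :: s).
  elim: (wf_lt x) => {}x _ IHx s; elim=> {}s acc_s IHs.
  have acc_s0 : Acc descent s by apply: Acc_intro.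
  (* A set all of whose elements lie in [s] or below [x] is accessible. *)
  have below (p : seq X) : (forall y, y \in p -> y \in s \/ lt y x) ->
      Acc descent p.
    move=> p_s; suff: Acc descent ([seq y <- p | y \notin s] ++ s).
      apply: Acc_subset => y yp; rewrite mem_cat mem_filter yp andbT.
      by case: (y \in s).
    have: forall y, y \in [seq y <- p | y \notin s] -> lt y x.
      by move=> y; rewrite mem_filter => /andP[/negP ys /p_s[]].
    elim: [seq y <- p | y \notin s] => [_|y q IHq lt_q]; first exact: acc_s0.
    rewrite cat_cons; apply: IHx; first by apply: lt_q; rewrite mem_head.
    by apply: IHq => z zq; apply: lt_q; rewrite in_cons zq orbT.
  apply: Acc_intro => t [m mxs [mt t_xs]].
  have [def_m|neq_mx] := eqVneq m x.
    apply: below => y yt; case: (t_xs y yt) => [|lt_ym]; last first.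
      by right; rewrite -def_m.
    rewrite in_cons => /orP[/eqP def_y|]; last by left.
    by case/negP: mt; rewrite def_m -def_y.
  move: mxs; rewrite in_cons (negPf neq_mx) /= => ms.
  apply: (@Acc_subset (x :: [seq y <- t | y != x])).
    by move=> y yt; rewrite in_cons mem_filter yt andbT; case: eqP.
  apply: IHs; exists m => //; split; first by rewrite mem_filter negb_and mt orbT.
  move=> y; rewrite mem_filter => /andP[/negPf neq_yx /t_xs].
  by rewrite in_cons neq_yx.
elim=> [|x s IHs]; last exact: Acc_cons.
by apply: Acc_intro => t [].
Qed.

End Descent.

(** * Shapes of matrices *)

Section Matrices.

Variable K : fieldType.
Implicit Types (M : imx K) (D : pred (nat * nat)).

Local Open Scope ring_scope.

(** All entries of [M] outside [D] agree with those of I.  The shapes of matrices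
    that matter are of this kind: membership in M_N(K), lower unitriangular, and
    of the form L_j(v). *)
Definition supported D M : bool := all D (finsupp M).

Lemma supportedP D M :
  reflect (forall a b, ~~ D (a, b) -> M (a, b) = (a == b)%:R)
          (supported D M).
Proof.
apply: (iffP allP) => [sM a b Dab|sM [a b] Mab].
  by rewrite fsfun_dflt //; apply: contra Dab => /sM.
by apply: contraTT Mab => Dab; rewrite memNfinsupp sM.
Qed.

Lemma imx_diagE n (A : nat -> nat -> K) a b :
  imx_diag n A (a, b) = if (a < n)%N && (b < n)%N then A a b else (a == b)%:R.
Proof.
rewrite /imx_diag fsfun_fun; congr (if _ then _ else _).
rewrite in_fset /=; apply/allpairsP/andP => /= [[[i j]] [/=]|[an bn]].
  by rewrite !mem_iota !add0n => /= ? ? [-> ->].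
by exists (a, b); rewrite !mem_iota.
Qed.

Lemma imx1E a b : (@imx1 K) (a, b) = (a == b)%:R.
Proof. by rewrite fsfun0E. Qed.

Lemma supported1 D : supported D (@imx1 K).
Proof. by apply/supportedP => a b _; rewrite imx1E. Qed.


Lemma sum_delta n a (f : nat -> K) : (a < n)%N ->
  \sum_(k < n) (a == k)%:R * f k = f a.
Proof.
move=> an; rewrite (bigD1 (Ordinal an)) //= eqxx mul1r big1 ?addr0 // => k.
by rewrite -(inj_eq val_inj) eq_sym => /negPf /= ->; rewrite mul0r.
Qed.

Definition in_box N (p : nat * nat) : bool := (p.1 < N)%N && (p.2 < N)%N.

Lemma imx_mul_box N M M' : supported (in_box N) M -> supported (in_box N) M' ->
  supported (in_box N) (imx_mul M M').
Proof.
rewrite /in_box => /supportedP sM /supportedP sM'.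
apply/supportedP => a b /= Dab.
rewrite imx_diagE; case: ifP => // /andP[a_n b_n].
set n := maxn _ _ in a_n b_n *.
have [leNa|lt_aN] := leqP N a.
  under eq_bigr => k _ do rewrite (sM a k) ?ltnNge ?leNa //.
  by rewrite (sum_delta (fun k => M' (k, b))) // sM' //= ltnNge leNa.
move: Dab; rewrite lt_aN /= => leNb.
under eq_bigr => k _ do rewrite (sM' k b) ?(negPf leNb) ?andbF // mulrC eq_sym.
by rewrite (sum_delta (fun k => M (a, k))) // sM //= (negPf leNb) andbF.
Qed.

Definition below_diag (p : nat * nat) : bool := (p.2 < p.1)%N.

(** For a <= b each product M a k * M' k b vanishes unless a = k = b. *)
Lemma imx_mul_unitri M M' : supported below_diag M -> supported below_diag M' ->
  supported below_diag (imx_mul M M').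
Proof.
rewrite /below_diag => /supportedP sM /supportedP sM'.
apply/supportedP => a b /=; rewrite -leqNgt => le_ab.
rewrite imx_diagE; case: ifP => // /andP[a_n b_n].
set n := maxn _ _ in a_n b_n *.
rewrite -[RHS](sum_delta (fun=> (a == b)%:R) a_n); apply: eq_bigr => k _.
have [lt_ak|lt_ka|a_k] := ltngtP a k.
- by rewrite sM /= -?leqNgt ?(ltnW lt_ak) // (ltn_eqF lt_ak) !mul0r.
- have lt_kb := leq_trans lt_ka le_ab.
  by rewrite (sM' k) /= -?leqNgt ?(ltnW lt_kb) // (ltn_eqF lt_kb) mulr0 mul0r.
- by rewrite /= -a_k sM /= -?leqNgt // sM' /= -?leqNgt // eqxx.
Qed.

Definition in_column j (p : nat * nat) : bool := (p.2 == j) && (j < p.1)%N.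

(** As [ent] reads a vector with absolute indices, its defining sum has at most
    one summand. *)
Lemma ent_neq0 n i (w : 'cV[K]_(n - i.+1)) k :
  ent w k != 0 -> exists2 p, (i.+1 + val p)%N = k & ent w k = w p ord0.
Proof.
have [p /eqP p_k|no_p] := pickP (fun p : 'I_(n - i.+1) => (i.+1 + p)%N == k).
  move=> _; exists p => //; rewrite /ent (bigD1 p) ?p_k //= big1 ?addr0 // => q.
  by case/andP=> /eqP; rewrite -p_k => /addnI/val_inj ->; rewrite eqxx.
by rewrite /ent big_pred0 ?eqxx.
Qed.

Lemma ent_out n i (w : 'cV[K]_(n - i.+1)) k :
  ~~ (i < k < n)%N -> ent w k = 0.
Proof.
apply: contraNeq => /ent_neq0[p <- _]; rewrite addSn ltnS leq_addr /=.
by have:= ltn_ord p; rewrite ltn_subRL.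
Qed.

Lemma ent_col n i (F : nat -> K) k :
  ent (\col_(p < n - i.+1) F (i.+1 + p)%N) k =
    if (i < k < n)%N then F k else 0.
Proof.
case: ifP => [/andP[ik kn]|/negbT]; last exact: ent_out.
have lt_p : (k - i.+1 < n - i.+1)%N by rewrite ltn_sub2r // (leq_ltn_trans ik).
rewrite /ent (bigD1 (Ordinal lt_p)) ?subnKC //= big1 ?addr0 ?mxE ?subnKC //.
move=> q /andP[/eqP q_k]; rewrite -(inj_eq val_inj) /= => /eqP[].
by rewrite -q_k addKn.
Qed.

Lemma ent_row n i (w : 'cV[K]_(n - i.+1)) (p : 'I_(n - i.+1)) :
  ent w (i.+1 + p) = w p ord0.
Proof.
rewrite /ent (bigD1 p) //= big1 ?addr0 // => q /andP[/eqP/addnI/val_inj ->].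
by rewrite eqxx.
Qed.

Lemma ent_opp n i (w : 'cV[K]_(n - i.+1)) k : ent (- w) k = - ent w k.
Proof. by rewrite /ent -sumrN; apply: eq_bigr => p _; rewrite mxE. Qed.

Lemma ent_add n i (w w' : 'cV[K]_(n - i.+1)) k :
  ent (w + w') k = ent w k + ent w' k.
Proof. by rewrite /ent -big_split; apply: eq_bigr => p _; rewrite mxE. Qed.

(** In the row of index [k], L_(j-i)(w) differs from I only through w_k. *)
Lemma ent_Lsub_mul n i j (w : 'cV[K]_(n - j.+1)) (v : 'cV[K]_(n - i.+1)) k :
  ent v k = 0 -> ent w k = 0 -> ent (Lsub i w *m v) k = 0.
Proof.
move=> v0 w0; have [//|nz] := eqVneq (ent (Lsub i w *m v) k) 0.
have [p p_k ->] := ent_neq0 nz; rewrite -[RHS]v0 -p_k ent_row !mxE.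
rewrite (bigD1 p) //= big1 ?addr0 => [|q /negPf neq_qp]; rewrite mxE p_k w0.
  by rewrite mulr0 addr0 eqxx mul1r.
by rewrite mulr0 addr0 eq_sym neq_qp mul0r.
Qed.

Lemma LmxE n i (v : 'cV[K]_(n - i.+1)) a b :
  Lmx v (a, b) = (a == b)%:R + (b == i)%:R * ent v a.
Proof.
rewrite imx_diagE; case: ifP => // /negbT; rewrite negb_and -!leqNgt => le_n.
have [b_i|_] := eqVneq b i; last by rewrite mul0r addr0.
rewrite ent_out ?mulr0 ?addr0 // negb_and -!leqNgt.
have [|lt_an] := leqP n a; first by rewrite orbT.
case/orP: le_n => [le_na|le_nb]; first by rewrite ltnNge le_na in lt_an.
by rewrite -b_i (ltnW (leq_trans lt_an le_nb)).
Qed.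

Lemma Lmx_column n i (v : 'cV[K]_(n - i.+1)) : supported (in_column i) (Lmx v).
Proof.
apply/supportedP => a b; rewrite LmxE negb_and /=.
case: eqP => /= [_ le_ai|_ _]; last by rewrite mul0r addr0.
by rewrite ent_out ?mulr0 ?addr0 // (negPf le_ai).
Qed.

Lemma imx_size_box M : supported (in_box (imx_size M)) M.
Proof.
apply/allP => p pM; rewrite /in_box -[X in is_true X]geq_max.
by rewrite /imx_size; apply: (bigmaxn_sup_seq _ pM).
Qed.

Lemma column_Lmx j M : supported (in_column j) M -> is_Lmx j M.
Proof.
move=> /supportedP sM; set n := imx_size M.
exists n, (\col_p M ((j.+1 + p)%N, j)); apply/fsfunP => -[a b].
rewrite LmxE (ent_col _ _ (fun k => M (k, j))).
have [->|neq_bj] := eqVneq b j; last first.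
  by rewrite mul0r addr0 sM //= negb_and neq_bj.
rewrite mul1r; case: ifP => [/andP[lt_ja _]|out].
  by rewrite (gtn_eqF lt_ja) add0r.
rewrite addr0; have [le_aj|lt_ja] := leqP a j.
  by rewrite sM //= negb_and -leqNgt le_aj orbT.
move/supportedP: (imx_size_box M) => -> //=.
by move: out; rewrite lt_ja /= /in_box /= => ->.
Qed.

Lemma column_below_diag j M :
  supported (in_column j) M -> supported below_diag M.
Proof. by apply: sub_all => p /andP[/eqP <-]. Qed.

Lemma Lmx_below_diag n i (v : 'cV[K]_(n - i.+1)) : supported below_diag (Lmx v).
Proof. exact/column_below_diag/Lmx_column. Qed.

Lemma Lmx_box N n i (v : 'cV[K]_(n - i.+1)) : (i < N)%N ->
  reflect (forall k, (N <= k)%N -> ent v k = 0) (supported (in_box N) (Lmx v)).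
Proof.
move=> lt_iN; apply: (iffP (supportedP _ _)) => [sv k leNk|v0 a b].
  have := sv k i; rewrite LmxE eqxx mul1r negb_and -leqNgt leNk => /(_ isT).
  by rewrite (gtn_eqF (leq_trans lt_iN leNk)) add0r.
rewrite LmxE negb_and -!leqNgt; case: (b =P i) => [-> |_ _]; last first.
  by rewrite mul0r addr0.
by rewrite orbC leqNgt lt_iN /= => /v0 ->; rewrite mulr0 addr0.
Qed.

End Matrices.

(** * The rank of a word *)

Section Words.

Variables (K : fieldType) (B : comAlgType K) (E : unital_basis B).
Variable N : nat.

Local Notation letter := (letter E).
Local Notation word := (seq letter).
Local Notation wM := (wM E).
Local Notation wA := (wA E).
Implicit Types (x : letter) (w u v W Z : word) (M : imx K) (s : seq nat).

Definition isA x : bool := if x is inr _ then true else false.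

Definition mx_with (p : pred (imx K)) x : bool :=
  if x is inl (inr M) then p (val M) else false.

(** Basis elements are not restricted: their variables never become indices of
    operators. *)
Definition bounded x : bool :=
  match x with
  | inl (inl _) => true
  | inl (inr M) => supported (in_box N) (val M)
  | inr i => i < N
  end.

Definition passive x : bool := bounded x && ~~ isA x.

Definition non_unitri := mx_with (fun M => ~~ supported below_diag M).
Definition any_mx := mx_with predT.
Definition non_column j := mx_with (fun M => ~~ supported (in_column j) M).

(** A basis element acts as n |-> n + 1 and a matrix as n |-> 2n + 1.  Both are
    increasing, and moving a basis element to the left of a matrix lowers the
    value, from 2 (n + 1) + 1 to (2n + 1) + 1. *)
Definition commutation_weight W : nat :=
  foldr (fun x n => if any_mx x then n.*2.+1 else n.+1) 0 W.

Definition block_rank i W : seq nat :=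
  [:: count non_unitri W; N - i; count any_mx W; count (non_column i) W;
      commutation_weight W].

(** Reading a word from the right, the state consists of the block read since
    the last operator and of the ranks of the complete blocks, rightmost block
    first. *)
Definition scan x (st : word * seq nat) : word * seq nat :=
  if x is inr i then ([::], st.2 ++ block_rank i st.1) else (x :: st.1, st.2).

Definition scan_word w st := foldr scan st w.

(** The block in front of all operators is ranked like a block behind A_0. *)
Definition word_rank w : seq nat :=
  let st := scan_word w ([::], [::]) in st.2 ++ block_rank 0 st.1.

(** The third case compares the current blocks only in so far as the comparison
    survives any letters to come on their left, so that [state_lt] is stable
    under reading further letters. *)
Definition state_lt (st st' : word * seq nat) : Prop :=
  [\/ size st.2 < size st'.2,
      size st.2 = size st'.2 /\ lexlt st.2 st'.2 |
      st.2 = st'.2 /\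
      forall i p, lexlt (block_rank i (p ++ st.1)) (block_rank i (p ++ st'.1))].

Lemma state_lt_scan x st st' :
  state_lt st st' -> state_lt (scan x st) (scan x st').
Proof.
case: st st' => [W s] [W' s']; rewrite /state_lt /=.
case: x => [x|i] /=; case=> [lt_s|[eq_s lt_s]|[-> lt_W]].
- by constructor 1.
- by constructor 2.
- constructor 3; split=> // j p.
  by rewrite -!(cat_rcons (inl x : letter)); apply: lt_W.
- by constructor 1; rewrite !size_cat /= ltn_add2r.
- by constructor 2; split; rewrite ?size_cat ?eq_s //; apply: lexlt_catl.
- constructor 2; split; rewrite ?size_cat //.
  by rewrite lexlt_catr; apply: (lt_W i [::]).
Qed.

(** Reduces the comparison of words to that of the two sides of a rule: the
    common suffix is an arbitrary initial state, and the common prefix preserves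
    [state_lt]. *)
Lemma state_lt_word_rank u v w w' :
  (forall st, state_lt (scan_word w st) (scan_word w' st)) ->
  shortlex (word_rank (u ++ w ++ v)) (word_rank (u ++ w' ++ v)).
Proof.
move=> lt_ww'; rewrite /word_rank /scan_word !foldr_cat -!/(scan_word _ _).
have: state_lt (scan_word u (scan_word w (scan_word v ([::], [::]))))
               (scan_word u (scan_word w' (scan_word v ([::], [::])))).
  elim: u => [|x u IHu]; first exact: lt_ww'.
  exact: state_lt_scan IHu.
case: (scan_word u _) => [W s]; case: (scan_word u _) => [W' s'].
rewrite /shortlex !size_cat ltn_add2r eqn_add2r.
case=> /= [->//|[-> lt_s]|[-> lt_W]].
  by rewrite eqxx (lexlt_catl _ _ lt_s) orbT.
by rewrite eqxx lexlt_catr orbC; apply/orP; left; apply: (lt_W 0 [::]).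
Qed.

Lemma scan_passive W V s :
  all passive W -> scan_word W (V, s) = (W ++ V, s).
Proof.
by elim: W => //= -[x|i] W IHW /andP[]; rewrite /passive ?andbF // => _ /IHW ->.
Qed.

Lemma scan_wA i W s : scan_word (wA i) (W, s) = ([::], s ++ block_rank i W).
Proof. by []. Qed.

Lemma scan_cat u v st : scan_word (u ++ v) st = scan_word u (scan_word v st).
Proof. exact: foldr_cat. Qed.

Lemma wB_passive b : all passive (wB b : word).
Proof. by rewrite /wB; case: insub. Qed.

Lemma wM_passive M : supported (in_box N) M -> all passive (wM M).
Proof.
by rewrite /wM; case: insubP => //= M' _ <-; rewrite /passive /= !andbT.
Qed.

Lemma bounded_wM M : all bounded (wM M) = supported (in_box N) M.
Proof.
rewrite /wM; case: insubP => [M' _ <-|] /=; first by rewrite andbT.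
by rewrite negbK => /eqP ->; rewrite supported1.
Qed.

Lemma passive_bounded W : all passive W -> all bounded W.
Proof. by apply: sub_all => x /andP[]. Qed.

Lemma count_mx_wB p b : count (mx_with p) (wB b : word) = 0.
Proof. by rewrite /wB; case: insub. Qed.

Lemma count_mx_wM p M : count (mx_with p) (wM M) = (M != imx1) && p M :> nat.
Proof.
rewrite /wM; case: insubP => [M' nM <-|/negPf ->] //=.
by rewrite addn0 (valP M').
Qed.

(** The identity matrix, which is the empty word, is of every shape. *)
Lemma count_non_supported_wM D M :
  count (mx_with (fun M => ~~ supported D M)) (wM M) = ~~ supported D M :> nat.
Proof.
rewrite count_mx_wM; case: eqP => //= ->.
by rewrite supported1.
Qed.

Lemma weight_wB b W :
  commutation_weight ((wB b : word) ++ W) = (b != gone E) + commutation_weight W.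
Proof. by rewrite /wB; case: insubP => [b' -> _|/negPf ->]. Qed.

Lemma weight_wM M W : M != imx1 ->
  commutation_weight (wM M ++ W) = (commutation_weight W).*2.+1.
Proof. by rewrite /wM; case: insubP => [//|/negPf ->]. Qed.

Lemma weight_monotone p W W' :
  commutation_weight W < commutation_weight W' ->
  commutation_weight (p ++ W) < commutation_weight (p ++ W').
Proof.
elim: p => //= x p IHp /IHp; case: ifP => _; last by rewrite ltnS.
by rewrite ltnS ltn_double.
Qed.

Lemma non_unitri_wB b : count non_unitri (wB b : word) = 0.
Proof. exact: count_mx_wB. Qed.

Lemma non_unitri_wM M :
  count non_unitri (wM M) = ~~ supported below_diag M :> nat.
Proof. exact: count_non_supported_wM. Qed.

(** This serves [RuleMulM]: if the product is not lower unitriangular, then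
    one of the factors is not either, so the first count does not grow. *)
Lemma segment_fewer_mx X Y :
  all passive X -> all passive Y ->
  count non_unitri X <= count non_unitri Y -> count any_mx X < count any_mx Y ->
  forall st, state_lt (scan_word X st) (scan_word Y st).
Proof.
move=> pX pY le_nu lt_mx [V s]; rewrite !scan_passive //.
constructor 3; split=> // i p; rewrite /block_rank !count_cat /=.
apply: lexlt_cons; first by rewrite leq_add2l leq_add2r.
apply: lexlt_cons => //; apply: lexlt_head.
by rewrite ltn_add2l ltn_add2r.
Qed.

(** This serves [Rule1] and [RuleMulB], which do not touch the matrices. *)
Lemma segment_lighter X Y :
  all passive X -> all passive Y ->
  (forall p, count (mx_with p) X <= count (mx_with p) Y) ->
  (forall V, commutation_weight (X ++ V) < commutation_weight (Y ++ V)) ->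
  forall st, state_lt (scan_word X st) (scan_word Y st).
Proof.
move=> pX pY le_mx lt_w [V s]; rewrite !scan_passive //.
constructor 3; split=> // i p; rewrite /block_rank !count_cat /=.
do 4!(apply: lexlt_cons; first by rewrite ?leq_add2l ?leq_add2r ?le_mx).
exact/lexlt_head/weight_monotone/lt_w.
Qed.

(** [Rule3] and [Rule4]: the block behind A_j loses a basis element. *)
Lemma pull_out X j b : all passive X -> wB b != [::] :> word ->
  forall st, state_lt (scan_word (X ++ wA j) st) (scan_word (wA j ++ wB b) st).
Proof.
rewrite /wB; case: insubP => //= {}b _ _ pX _ [V s].
rewrite scan_cat scan_wA scan_passive //.
constructor 2; split; rewrite /= ?size_cat // lexlt_catr.
by do 4!apply: lexlt_cons => //; apply: lexlt_head.
Qed.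

Lemma fewer_operators X j W : all passive X -> all passive W ->
  forall st, state_lt (scan_word X st) (scan_word (wA j ++ W) st).
Proof.
move=> pX pW [V s].
rewrite scan_cat (scan_passive V s pX) (scan_passive V s pW) scan_wA.
by constructor 1; rewrite /= size_cat /= -[ltnLHS]addn0 ltn_add2l.
Qed.

Lemma operators_merge X i Y j W k : all passive X -> all passive Y ->
  all passive W ->
  forall st, state_lt (scan_word (X ++ wA i ++ Y) st)
                      (scan_word (wA j ++ W ++ wA k) st).
Proof.
move=> pX pY pW [V s]; rewrite !scan_cat (scan_passive V s pY) !scan_wA.
rewrite (scan_passive _ _ pX) (scan_passive _ _ pW) scan_wA.
by constructor 1; rewrite /= !size_cat /= -[ltnLHS]addn0 ltn_add2l.
Qed.

(** The common form of [Rule7], [Rule8] and [RuleSwapA].  On the right side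
    the last block starts with no other matrices than lower unitriangular ones,
    so it beats the old one by the index k > i of its operator. *)
Lemma operators_reordered X i Y k Z j Y' Z' : i < k -> i < N ->
  all passive X -> all passive Y -> all passive Z ->
  all passive Y' -> all passive Z' -> count non_unitri Z = 0 ->
  forall st, state_lt (scan_word (X ++ wA i ++ Y ++ wA k ++ Z) st)
                      (scan_word (wA j ++ Y' ++ wA i ++ Z') st).
Proof.
move=> lt_ik lt_iN pX pY pZ pY' pZ' nuZ [V s].
rewrite !scan_cat (scan_passive V s pZ) (scan_passive V s pZ') !scan_wA.
rewrite (scan_passive _ _ pY) (scan_passive _ _ pY') !scan_wA.
rewrite (scan_passive _ _ pX).
constructor 2; split; rewrite /= ?size_cat // -!catA lexlt_catr.
rewrite /block_rank !count_cat nuZ add0n /=; apply: lexlt_cons.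
  exact: leq_addl.
by apply: lexlt_head; rewrite ltn_sub2l.
Qed.

(** [Rule5]: either M was not lower unitriangular and L is, or the index stays
    and L, unlike M, has the form of the matrices that are irreducible there. *)
Lemma operator_turned X i c L j b M :
  all passive X -> supported (in_box N) M -> supported (in_box N) L ->
  supported below_diag L ->
  (supported below_diag M ->
     [/\ i = j, M != imx1, supported (in_column j) L &
         ~~ supported (in_column j) M]) ->
  forall st, state_lt (scan_word (X ++ wA i ++ wB c ++ wM L) st)
                      (scan_word (wA j ++ wB b ++ wM M) st).
Proof.
move=> pX boxM boxL uL M_bad [V s].
have pW d M' : supported (in_box N) M' -> all passive (wB d ++ wM M').
  by move=> boxM'; rewrite all_cat wB_passive wM_passive.
rewrite scan_cat (scan_cat (wA i)) (scan_cat (wA j)).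
rewrite (scan_passive V s (pW c L boxL)) (scan_passive V s (pW b M boxM)).
rewrite !scan_wA (scan_passive _ _ pX).
constructor 2; split; rewrite /= ?size_cat // lexlt_catr /block_rank !count_cat.
rewrite !non_unitri_wB !non_unitri_wM uL !count_mx_wB !add0n.
have [/M_bad[-> M1 cL cM]|_] := boolP (supported below_diag M); last first.
  by apply: lexlt_head; rewrite add1n.
do 2!(apply: lexlt_cons; first by []).
apply: lexlt_cons; first by rewrite !count_mx_wM M1 !andbT leq_add2r leq_b1.
apply: lexlt_head.
by rewrite !count_non_supported_wM cL cM ltn_add2r.
Qed.

End Words.

Local Open Scope ring_scope.

(** * Supports of right-hand sides *)

Section Supports.

Variables (K : fieldType) (B : comAlgType K) (E : unital_basis B).

Local Notation word := (seq (letter E)).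
Local Notation freealg := (freealg E).
Implicit Types (P Q R : word -> Prop) (a b : freealg).

(** For most right-hand sides only the shape of the words matters and not the
    coefficients; [spanned] and its closure properties keep track of it. *)
Definition spanned P a : Prop :=
  forall m : {fmonom letter E}, m \in msupp a -> P m.

Definition cat_of P Q w : Prop := exists u v, [/\ P u, Q v & w = u ++ v].

Lemma spannedW P Q a : (forall w, P w -> Q w) -> spanned P a -> spanned Q a.
Proof. by move=> PQ sa m /sa /PQ. Qed.

Lemma spanned_mon P w : P w -> spanned P (mon w).
Proof. by move=> Pw m; rewrite msuppU1 in_fset1 => /eqP ->. Qed.

Lemma spanned0 P : spanned P 0.
Proof. by move=> m; rewrite msupp0 in_fset0. Qed.

Lemma spannedD P a b : spanned P a -> spanned P b -> spanned P (a + b).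
Proof.
by move=> sa sb m /(fsubsetP (msuppD_le _ _)); rewrite in_fsetU => /orP[/sa|/sb].
Qed.

Lemma spannedB P a b : spanned P a -> spanned P b -> spanned P (a - b).
Proof. by move=> sa sb; apply: spannedD => // m; rewrite msuppN => /sb. Qed.

Lemma spannedZ P c a : spanned P a -> spanned P (c *: a).
Proof. by move=> sa m /(fsubsetP (msuppZ_le _ _)) /sa. Qed.

Lemma spanned_lext P (X : choiceType) (f : X -> freealg) m :
  (forall x, spanned P (f x)) -> spanned P (lext f m).
Proof.
move=> sf; rewrite /lext; apply: big_ind => [|a b|x _]; first exact: spanned0.
  exact: spannedD.
exact: spannedZ.
Qed.

Lemma spannedM P Q a b :
  spanned P a -> spanned Q b -> spanned (cat_of P Q) (a * b).
Proof.
move=> sa sb m /msuppM_le [u [v [/sa Pu /sb Qv ->]]].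
by exists u, v; split=> //; rewrite /mmul /= fmmulE.
Qed.

Lemma spanned_fG P (g : galg E) : (forall x, P (wB x)) -> spanned P (fG g).
Proof. by move=> PB; apply: spanned_lext => x; apply: spanned_mon. Qed.

Lemma spanned_fG_wB (g : galg E) : spanned (fun w => exists x, w = wB x) (fG g).
Proof. by apply: spanned_fG => x; exists x. Qed.

Lemma spanned1 P : P [::] -> spanned P 1.
Proof.
move=> P0 m; rewrite -mcoeff_neq0 mcoeff1.
by case: (m =P _) => [->|_]; rewrite ?fm1 ?eqxx.
Qed.

End Supports.

(** * Every rule decreases the rank *)

Section Rules.

Variables (K : fieldType) (B : comAlgType K) (E : unital_basis B).
Variables (H : scaled_rb_bialgebra E) (N : nat).

Local Notation word := (seq (letter E)).
Local Notation freealg := (freealg E).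
Local Notation wA := (wA E).
Local Notation wM := (wM E).
Local Notation passive_span := (spanned (fun w : word => all (passive N) w)).

Lemma passive_spanM (a b : freealg) :
  passive_span a -> passive_span b -> passive_span (a * b).
Proof.
move=> sa sb; apply: spannedW (spannedM sa sb) => _ [u [v [pu pv ->]]].
by rewrite all_cat pu pv.
Qed.

Lemma passive_span_fG (g : galg E) : passive_span (fG g).
Proof. by apply: spanned_fG => x; apply: wB_passive. Qed.

Lemma passive_span_fM M : supported (in_box N) M -> passive_span (fM E M).
Proof. by move=> bM; apply: spanned_mon; apply: wM_passive. Qed.

Lemma Emx_box j : (j < N)%N -> supported (in_box N) (Emx j : imx K).
Proof.
move=> ltjN; apply/supportedP => x y; rewrite /Emx fsfun_withE.
by case: eqP => [[-> ->]|_ _]; rewrite ?imx1E // /in_box /= ltjN.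
Qed.

Lemma passive_span_1E j : (j < N)%N -> passive_span (1 - fM E (Emx j)).
Proof.
move=> ltjN; apply: spannedB; first exact: spanned1.
exact/passive_span_fM/Emx_box.
Qed.

(** The words that occur on the right-hand sides of [Rule7], [Rule8] and
    [RuleSwapA]. *)
Definition reordered i k (w : word) : Prop := exists X Y Z,
  [/\ w = X ++ wA i ++ Y ++ wA k ++ Z,
      all (passive N) X, all (passive N) Y, all (passive N) Z &
      count (@non_unitri K B E) Z = 0].

Definition one_op i (w : word) : Prop := exists X Y,
  [/\ w = X ++ wA i ++ Y, all (passive N) X & all (passive N) Y].

Lemma spanned_one_op_fA i : spanned (one_op i) (fA E i).
Proof. by apply: spanned_mon; exists [::], [::]. Qed.

Lemma spanned_one_op_mull i (a b : freealg) :
  passive_span a -> spanned (one_op i) b -> spanned (one_op i) (a * b).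
Proof.
move=> sa sb; apply: spannedW (spannedM sa sb).
move=> w [U [w' [pU [X [Y [-> pX pY]]] ->]]]; exists (U ++ X), Y.
by rewrite -catA all_cat pU.
Qed.

Lemma spanned_one_op_mulr i (a b : freealg) :
  spanned (one_op i) a -> passive_span b -> spanned (one_op i) (a * b).
Proof.
move=> sa sb; apply: spannedW (spannedM sa sb).
move=> w [w' [U [[X [Y [-> pX pY]]] pU ->]]]; exists X, (Y ++ U).
by rewrite -!catA all_cat pY.
Qed.

Lemma spanned_reordered i k (a : freealg) (g : galg E) M :
  spanned (one_op i) a -> supported (in_box N) M -> supported below_diag M ->
  spanned (reordered i k) (a * fA E k * fG g * fM E M).
Proof.
move=> sa boxM uM.
have sA : spanned (eq (wA k)) (fA E k) by apply: spanned_mon.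
have sM : spanned (eq (wM M)) (fM E M) by apply: spanned_mon.
have sG := spanned_fG_wB (g := g).
apply: spannedW (spannedM (spannedM (spannedM sa sA) sG) sM).
move=> w [w5 [_ [w5P <- ->]]]; case: w5P => [w4 [_ [w4P [x ->] ->]]].
case: w4P => [w3 [_ [w3P <- ->]]]; case: w3P => [X [Y [-> pX pY]]].
exists X, Y, (wB x ++ wM M); rewrite -!catA; split=> //.
  by rewrite all_cat wB_passive wM_passive.
by rewrite count_cat non_unitri_wB non_unitri_wM uM.
Qed.

Lemma fG_gvar i (x : E) : fG (gvar i x) = mon (wB (gsingle i x)).
Proof.
by rewrite /fG /lext /gvar msuppU oner_eq0 big_seq_fset1 mcoeffUU scale1r.
Qed.

Lemma monM (u v : word) : mon u * mon v = mon (u ++ v).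
Proof. by rewrite /mon -[LHS]/(fgmul _ _) fgmulUU mulr1 /mmul /= fmmulE. Qed.

(** In every context, [r] gives a word of smaller rank than [lhs] does, by
    [state_lt_word_rank]. *)
Definition smaller (lhs r : word) : Prop :=
  all (bounded N) r /\
  forall st, state_lt N (scan_word N r st) (scan_word N lhs st).

Lemma all_bounded_wB b : all (bounded N) (wB b : word).
Proof. exact/passive_bounded/wB_passive. Qed.

Lemma reordered_smaller i k j X Y : (i < k)%N -> (i < N)%N -> (k < N)%N ->
  all (passive N) X -> all (passive N) Y ->
  forall r, reordered i k r -> smaller (wA j ++ X ++ wA i ++ Y) r.
Proof.
move=> lt_ik lt_iN lt_kN pX pY _ [U [V [W [-> pU pV pW nuW]]]]; split.
  rewrite !all_cat (passive_bounded pU) (passive_bounded pV).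
  by rewrite (passive_bounded pW) /= lt_iN lt_kN.
exact: operators_reordered.
Qed.

(** The expansion of b[M] consists of scalar multiples of basis elements, so that
    M b becomes c M or, for c = 1, just M. *)
Lemma rule1_smaller M b g : M != imx1 -> b != gone E ->
  all (bounded N) (wM M ++ wB b) ->
  spanned (smaller (wM M ++ wB b)) (fG g * fM E M).
Proof.
move=> M1 b1; rewrite all_cat bounded_wM => /andP[boxM _].
have sM : spanned (eq (wM M)) (fM E M) by apply: spanned_mon.
apply: spannedW (spannedM (spanned_fG_wB (g := g)) sM).
move=> w [_ [_ [[c ->] <- ->]]].
have pM := wM_passive E boxM.
split; first by rewrite all_cat all_bounded_wB passive_bounded.
apply: segment_lighter; rewrite ?all_cat ?wB_passive ?pM //.
  by move=> p; rewrite !count_cat !count_mx_wB addn0.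
move=> V; rewrite -!catA !(weight_wB, weight_wM) // b1.
by rewrite add1n doubleS ltnS; case: (c != _); rewrite ?add1n ?add0n.
Qed.

(** As M_ij is nonzero, i lies in the index range if j does.  If M is lower
    unitriangular, its column j starts at the diagonal, which yields i = j. *)
Lemma rule5_smaller n M i j (g : E) :
  (imx_size M <= n)%N -> (i < n)%N -> (j < n)%N ->
  M (i, j) != 0 -> (forall k, (k < i)%N -> M (k, j) = 0) ->
  ~ is_Lmx j M ->
  all (bounded N) (wA j ++ wB (gsingle j g) ++ wM M) ->
  spanned (smaller (wA j ++ wB (gsingle j g) ++ wM M)) (rhs5 H n M i j g).
Proof.
move=> le_n lt_in lt_jn Mij Mmin notL.
rewrite !all_cat bounded_wM /= andbT => /and3P[lt_jN _ boxM].
have ncM : ~~ supported (in_column j) M.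
  by apply/negP => /column_Lmx.
have M0 k : (N <= k)%N -> M (k, j) = 0.
  move=> leNk; move/supportedP: boxM => ->; last by rewrite negb_and -leqNgt leNk.
  by rewrite (gtn_eqF (leq_trans lt_jN leNk)).
have lt_iN : (i < N)%N by rewrite ltnNge; apply: contra Mij => /M0 ->.
rewrite /rhs5; set l := \col_p _; set M' := imx_mul _ _.
have boxL : supported (in_box N) (Lmx l).
  apply/Lmx_box => // k /M0 Mk0.
  by rewrite (ent_col _ _ (fun k => M (k, j) / M (i, j))) Mk0 mul0r if_same.
have boxM' : supported (in_box N) M'.
  apply: imx_mul_box boxM; apply/Lmx_box => // k leNk; rewrite ent_opp.
  by move/(Lmx_box _ lt_iN): boxL => -> //; rewrite oppr0.
apply: spanned_lext => b; apply: spannedZ.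
have sA : spanned (eq (wA i)) (fA E i) by apply: spanned_mon.
have sL : spanned (eq (wM (Lmx l))) (fM E (Lmx l)) by apply: spanned_mon.
have pre : passive_span (fG << greset b j >> * (1 - fM E (Emx j)) * fM E M').
  apply: passive_spanM (passive_span_fM boxM').
  by apply: passive_spanM; [apply: passive_span_fG | apply: passive_span_1E].
have sG := spanned_fG_wB (g := mx_act H (swapmx i j)
  (mx_act H (dmx j (M (i, j))^-1) (gvar j (b j)))).
apply: spannedW (spannedM (spannedM (spannedM pre sA) sG) sL).
move=> w [w4 [_ [w4P <- ->]]]; case: w4P => [w3 [_ [w3P [c ->] ->]]].
case: w3P => [X [_ [pX <- ->]]]; rewrite -!catA; split.
  by rewrite !all_cat passive_bounded //= lt_iN all_bounded_wB bounded_wM.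
apply: operator_turned => //; first exact: Lmx_below_diag.
move/supportedP=> uM.
have ij : i = j.
  apply/eqP; rewrite eqn_leq andbC; apply/andP; split.
    rewrite leqNgt; apply: contra Mij => lt_ij; rewrite uM ?(ltn_eqF lt_ij) //.
    by rewrite /below_diag -leqNgt ltnW.
  rewrite leqNgt; apply/negP => /Mmin; rewrite uM ?eqxx; last first.
    by rewrite /below_diag ltnn.
  by apply/eqP/oner_neq0.
split=> //; last by rewrite -ij; apply: Lmx_column.
by apply: contraNneq ncM => ->; apply: supported1.
Qed.

Lemma rule7_smaller n i j (h g : E) (w : 'cV[K]_(n - j.+1))
    (v : 'cV[K]_(n - i.+1)) :
  (i < j)%N ->
  let lhs := wA j ++ wB (gsingle j h) ++ wM (Lmx w)
             ++ wA i ++ wB (gsingle i g) ++ wM (Lmx v) in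
  all (bounded N) lhs -> spanned (smaller lhs) (rhs7 H h g w v).
Proof.
move=> lt_ij lhs; rewrite !all_cat !bounded_wM /= !andbT.
case/and4P=> lt_jN _ boxw /and3P[lt_iN _ boxv].
have /(Lmx_box _ lt_jN) w0 := boxw; have /(Lmx_box _ lt_iN) v0 := boxv.
have pW b M : supported (in_box N) M -> all (passive N) (wB b ++ wM M).
  by move=> boxM; rewrite all_cat wB_passive wM_passive.
have boxv' : supported (in_box N) (Lmx (Lsub i (- w) *m v)).
  apply/(Lmx_box _ lt_iN) => k leNk.
  by apply: ent_Lsub_mul; rewrite ?ent_opp ?w0 ?v0 ?oppr0.
apply: spanned_lext => b.
apply: (@spannedW _ _ _ (reordered i j)) => [r|].
  move/(reordered_smaller j lt_ij lt_iN lt_jN (pW (gsingle j h) _ boxw)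
          (pW (gsingle i g) _ boxv)).
  by rewrite -!catA.
apply: spanned_reordered => //; last exact: Lmx_below_diag.
apply: spanned_one_op_mulr _ (passive_span_fM boxv').
apply: spanned_one_op_mulr _ (@passive_span_fG _).
exact: spanned_one_op_mull (passive_span_1E lt_jN) (@spanned_one_op_fA i).
Qed.

(** The auxiliary variable of index [n] of this rule only occurs inside of basis
    elements, and k lies in the index range because w_k is nonzero. *)
Lemma rule8_smaller n i k (h g : E) (w v : 'cV[K]_(n - i.+1)) :
  (i < k)%N -> ent w k != 0 ->
  let lhs := wA i ++ wB (gsingle i h) ++ wM (Lmx w)
             ++ wA i ++ wB (gsingle i g) ++ wM (Lmx v) in
  all (bounded N) lhs -> spanned (smaller lhs) (rhs8 H k h g w v).
Proof.
move=> lt_ik wk lhs; rewrite !all_cat !bounded_wM /= !andbT.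
case/and4P=> lt_iN _ boxw /and3P[_ _ boxv].
have /(Lmx_box _ lt_iN) w0 := boxw; have /(Lmx_box _ lt_iN) v0 := boxv.
have lt_kN : (k < N)%N by rewrite ltnNge; apply: contra wk => /w0 ->.
have pW b M : supported (in_box N) M -> all (passive N) (wB b ++ wM M).
  by move=> boxM; rewrite all_cat wB_passive wM_passive.
rewrite /rhs8; set w' := \col_p _; set wbar := \col_p _.
set v' := Lsub i (- w') *m v.
have wbar0 m : (N <= m)%N -> ent wbar m = 0.
  move=> leNm.
  have -> : ent wbar m = if (i < m < n)%N then (m == k)%:R * ent w k else 0.
    exact: (ent_col _ _ (fun m => (m == k)%:R * ent w k)).
  by rewrite (gtn_eqF (leq_trans lt_kN leNm)) mul0r if_same.
have w'0 m : (N <= m)%N -> ent w' m = 0.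
  move=> leNm.
  have -> : ent w' m = if (k < m < n)%N then ent w m / ent w k else 0.
    exact: (ent_col _ _ (fun m => ent w m / ent w k)).
  rewrite w0 //.
  by rewrite mul0r if_same.
have v'0 m : (N <= m)%N -> ent v' m = 0.
  by move=> leNm; apply: ent_Lsub_mul; rewrite ?ent_opp ?w'0 ?v0 ?oppr0.
have smaller_reordered r : reordered i k r -> smaller lhs r.
  move/(reordered_smaller i lt_ik lt_iN lt_kN (pW (gsingle i h) _ boxw)
          (pW (gsingle i g) _ boxv)).
  by rewrite -!catA.
have boxw' : supported (in_box N) (Lmx w') by apply/Lmx_box.
have pre g' : passive_span (fM E (Lmx (- w')) * fG g').
  apply: passive_spanM; [apply: passive_span_fM | exact: passive_span_fG].
  by apply/Lmx_box => // m /w'0; rewrite ent_opp => ->; rewrite oppr0.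
have box_Lmx (u : 'cV[K]_(n - i.+1)) :
    (forall m, (N <= m)%N -> ent u m = 0) -> passive_span (fM E (Lmx u)).
  by move=> u0; apply/passive_span_fM/Lmx_box.
apply: spanned_lext => b; apply: (spannedW smaller_reordered).
apply: spanned_reordered => //; last exact: Lmx_below_diag.
apply: spanned_one_op_mull (pre _) _; apply: spannedB.
  apply: spanned_one_op_mulr _ (box_Lmx _ v'0).
  apply: spanned_one_op_mulr _ (@passive_span_fG _).
  exact: spanned_one_op_mull (box_Lmx _ wbar0) (@spanned_one_op_fA i).
apply: spanned_one_op_mulr _ (box_Lmx _ _) => [|m leNm].
  exact: spanned_one_op_mulr (@spanned_one_op_fA i) (@passive_span_fG _).
by rewrite ent_add v'0 ?wbar0 ?addr0.
Qed.

(** [Rule3] and [Rule4] have equal sides when the basis element is 1, whence the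
    assumption that the two sides differ. *)
Lemma rule_smaller lhs rhs :
  rule H lhs rhs -> mon lhs != rhs -> all (bounded N) lhs ->
  spanned (smaller lhs) rhs.
Proof.
have pull i j (x : E) :
    mon (wA j ++ wB (gsingle i x)) != fG (gvar i x) * fA E j ->
    all (bounded N) (wA j ++ wB (gsingle i x)) ->
    spanned (smaller (wA j ++ wB (gsingle i x))) (fG (gvar i x) * fA E j).
  rewrite fG_gvar monM => neq_sides /= /andP[lt_jN _]; apply: spanned_mon; split.
    by rewrite all_cat all_bounded_wB /= lt_jN.
  apply: pull_out; first exact: wB_passive.
  by apply: contraNneq neq_sides => ->.
case=> {lhs rhs}.
- by move=> M b M1 b1 _; apply: rule1_smaller.
- by move=> M i _ _ _; apply: spanned0.
- by move=> i j x _; apply: pull.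
- by move=> i j x _; apply: pull.
- by move=> n M i j g le_n lt_i lt_j Mij Mmin notL _; apply: rule5_smaller.
- move=> M j g _ _; rewrite !all_cat bounded_wM /= => /and3P[_ _ boxM].
  have sM : spanned (eq (wM M)) (fM E M) by apply: spanned_mon.
  apply: spannedW (passive_spanM (@passive_span_fG _) (passive_span_fM boxM)).
  move=> r pr; split; first exact: passive_bounded.
  by apply: fewer_operators; rewrite // all_cat wB_passive wM_passive.
- by move=> n i j h g w v lt_ij _ _; apply: rule7_smaller.
- by move=> n i k h g w v lt_ik _ wk _ _; apply: rule8_smaller.
- move=> j g _; rewrite !all_cat /= => /and3P[lt_jN _ _].
  have sA : spanned (eq (wA j)) (fA E j) by apply: spanned_mon.
  apply: spannedB.
    apply: spannedW (spannedM (@passive_span_fG _) sA) => w [X [_ [pX <- ->]]].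
    split; first by rewrite all_cat passive_bounded //= lt_jN.
    have nil_passive : all (passive N) ([::] : word) by [].
    have := operators_merge j j j pX nil_passive (wB_passive N (gsingle j g)).
    by rewrite cats0.
  apply: spannedW (spannedM sA (@passive_span_fG _)) => w [_ [Y [<- pY ->]]].
  split; first by rewrite all_cat /= lt_jN passive_bounded.
  by apply: (@operators_merge _ _ _ _ [::]) => //; apply: wB_passive.
- move=> b c b1 c1 _ _; apply: spannedW (spanned_fG_wB (g := _)) => _ [x ->].
  split; first exact: all_bounded_wB.
  apply: segment_lighter; rewrite ?all_cat ?wB_passive //.
    by move=> p; rewrite count_mx_wB.
  by move=> V; rewrite -catA !weight_wB b1 c1 ltnS; case: (x != _).
- move=> M M' M1 M1' _; rewrite all_cat !bounded_wM => /andP[boxM boxM'].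
  have box_mul := imx_mul_box boxM' boxM.
  apply: spanned_mon; split; first by rewrite bounded_wM.
  apply: segment_fewer_mx; rewrite ?all_cat ?wM_passive // !count_cat.
    rewrite !non_unitri_wM.
    case: (boolP (supported _ M)) => [uM|_]; last first.
      by case: (supported _ (imx_mul _ _)).
    case: (boolP (supported _ M')) => [uM'|_]; last by case: (supported _ _).
    by rewrite imx_mul_unitri.
  by rewrite !count_mx_wM M1 M1'; case: (_ != _).
- move=> i j lt_ij _ /= /and3P[lt_jN lt_iN _]; rewrite monM; apply: spanned_mon.
  apply: (@reordered_smaller i j j [::] [::]) => //.
  by exists [::], [::], [::].
Qed.

End Rules.

(** * Termination *)

Section Reductions.

Variables (K : fieldType) (B : comAlgType K) (E : unital_basis B).
Variables (H : scaled_rb_bialgebra E).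

Local Notation word := (seq (letter E)).
Local Notation freealg := (freealg E).

Definition word_lt N (u v : {fmonom letter E}) : Prop :=
  shortlex (word_rank N u) (word_rank N v).

Lemma word_lt_wf N : well_founded (word_lt N).
Proof. exact: wf_inverse_image shortlex_wf. Qed.

(** The reduced monomial [m] cannot reappear: its coefficient is cancelled, and
    the new monomials are strictly smaller than [m]. *)
Lemma reduces_descent N a a' : reduces H a a' ->
  spanned (fun w : word => all (bounded N) w) a ->
  spanned (fun w : word => all (bounded N) w) a' /\
  descent (word_lt N) (msupp a' : seq _) (msupp a : seq _).
Proof.
case=> u [v [lhs [rhs]]]; set c := _@__ => -[lhs_rhs neq_sides c0 ->] boxa.
set m := FMonom (u ++ lhs ++ v) in c c0 *.
have ma : m \in msupp a by rewrite -mcoeff_neq0.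
have := boxa _ ma; rewrite /= !all_cat => /and3P[box_u box_lhs box_v].
set new := mon u * rhs * mon v.
have new_lt : spanned (fun w : word => all (bounded N) w /\
    shortlex (word_rank N w) (word_rank N (u ++ lhs ++ v))) new.
  have sW w : spanned (eq w) (mon w : freealg) by apply: spanned_mon.
  have srhs := rule_smaller lhs_rhs neq_sides box_lhs.
  apply: spannedW (spannedM (spannedM (sW u) srhs) (sW v)).
  move=> w [w' [_ [[_ [r [<- [box_r lt_r] ->]]] <- ->]]].
  rewrite -catA !all_cat box_u box_r box_v; split=> //.
  exact: state_lt_word_rank.
have m_new : m \notin msupp new.
  apply/negP => /new_lt[_]; rewrite /shortlex ltnn /=.
  by rewrite eqxx /= lexlt_irr.
have supp_a' y : y \in msupp (a - c *: mon (u ++ lhs ++ v) + c *: new) ->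
    y \in msupp a \/ y \in msupp new.
  move/(fsubsetP (msuppD_le _ _)); rewrite in_fsetU => /orP[|].
    move/(fsubsetP (msuppB_le _ _)); rewrite in_fsetU => /orP[|]; first by left.
    by move/(fsubsetP (msuppZ_le _ _)); rewrite msuppU1 in_fset1 => /eqP ->; left.
  by move/(fsubsetP (msuppZ_le _ _)); right.
split=> [y /supp_a'[/boxa|/new_lt[]] //|].
exists m => //; split=> [|y /supp_a'[|/new_lt[_]]]; [|by left|by right].
rewrite -mcoeff_eq0 mcoeffD mcoeffB !mcoeffZ mcoeffUU mulr1 subrr add0r.
by rewrite (mcoeff_outdom m_new) mulr0.
Qed.

Definition letter_size (x : letter E) : nat :=
  match x with
  | inl (inl _) => 0
  | inl (inr M) => imx_size (val M)
  | inr i => i.+1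
  end.

Lemma bounded_letter_size N x : (letter_size x <= N)%N -> bounded N x.
Proof.
case: x => [[b|M]|i] //= le_N; apply: sub_all (imx_size_box (val M)) => p.
by case/andP=> lt1 lt2; rewrite /in_box !(leq_trans _ le_N).
Qed.

Lemma bounded_support (a : freealg) :
  exists N, spanned (fun w : word => all (bounded N) w) a.
Proof.
exists (\max_(m <- msupp a) \max_(x <- m : word) letter_size x) => m ma.
apply/allP => x xm; apply: bounded_letter_size.
apply: leq_trans (leq_bigmax_seq _ ma _) => //.
exact: (leq_bigmax_seq _ xm).
Qed.

End Reductions.

Theorem theorem4p10 (K : fieldType) (charK0 : [pchar K] =i pred0)
    (B : comAlgType K) (E : unital_basis B) (H : scaled_rb_bialgebra E) :
  noetherian (@reduces K B E H).
Proof.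
case=> s red_s; have [N box0] := bounded_support (s 0%N).
have box n : spanned (fun w : seq (letter E) => all (bounded N) w) (s n).
  by elim: n => // n /(reduces_descent (red_s n)) [].
have desc n : descent (word_lt N) (msupp (s n.+1) : seq _) (msupp (s n) : seq _).
  by have [] := reduces_descent (red_s n) (box n).
suff /(_ _ (descent_wf (@word_lt_wf K B E N) _) 0%N) : forall t : seq _,
    Acc (descent (word_lt N)) t -> forall n, (msupp (s n) : seq _) = t -> False.
  exact.
move=> t; elim=> {}t _ IHt n def_t.
by apply: (IHt (msupp (s n.+1))) (erefl _); rewrite -def_t.
Qed.
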